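(* Let $(G_i): 0\to N_i\xrightarrow{\chi_i} G_i\xrightarrow{\pi_i} Q_i\to 0$, $i=1,2$, be central extensions of algebras with bracket (AWB's), and let $\eta: Q_1\to Q_2$ be an isomorphism of AWB's. Then the following statements are equivalent: (a) $\eta$ induces an isoclinism from $(G_1)$ to $(G_2)$, i.e. there is an isomorphism $\xi:[[G_1,G_1]]\to[[G_2,G_2]]$ such that $(\eta,\xi)$ is an isoclinism from $(G_1)$ to $(G_2)$. (b) There exists an isomorphism $\beta':[[G_1,G_1]]\to[[G_2,G_2]]$ with $\beta'\circ\theta'(G_1)=\theta'(G_2)\circ H_1^{AWB}(\eta)$. (c) $H_1^{AWB}(\eta)(\mathrm{Ker}(\theta(G_1)))=\mathrm{Ker}(\theta(G_2))$.
   Context: Fix a ground field $\mathbb{K}$; all vector spaces and tensor products are over $\mathbb{K}$. An algebra with bracket (AWB) is an associative (not necessarily commutative, not necessarily unital) $\mathbb{K}$-algebra $A$ with a bilinear map $[-,-]:A\times A\to A$ satisfying $[ab,c]=[a,c]b+a[b,c]$ for all $a,b,c\in A$ (nothing else is required of the bracket). Homomorphisms of AWB's are $\mathbb{K}$-linear maps preserving product and bracket; isomorphisms are bijective homomorphisms. $[[A,A]]$ denotes the two-sided ideal of $A$ spanned by all $ab$ and $[a,b]$, $a,b\in A$. The center is $Z(A)=\{a\in A: ab=ba=0,\ [a,b]=[b,a]=0\ \forall b\in A\}$. A central extension $(G): 0\to N\xrightarrow{\chi}G\xrightarrow{\pi}Q\to 0$ is a short exact sequence of AWB's with $\chi(N)\subseteq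 Z(G)$. Its commutator maps $C,P:Q\times Q\to[[G,G]]$ are $C(q_1,q_2)=[g_1,g_2]$ and $P(q_1,q_2)=g_1g_2$, where $\pi(g_j)=q_j$. For central extensions $(G_1),(G_2)$ with commutator maps $C_i,P_i$, an isoclinism from $(G_1)$ to $(G_2)$ is a pair $(\eta,\xi)$ of AWB isomorphisms $\eta:Q_1\to Q_2$, $\xi:[[G_1,G_1]]\to[[G_2,G_2]]$ with $\xi(C_1(q,q'))=C_2(\eta(q),\eta(q'))$ and $\xi(P_1(q,q'))=P_2(\eta(q),\eta(q'))$ for all $q,q'\in Q_1$. Homology: for an AWB $A$, let $d_1:A^{\otimes 2}\oplus A^{\otimes 2}\to A$ and $d_2:A^{\otimes 3}\oplus A^{\otimes 3}\to A^{\otimes 2}\oplus A^{\otimes 2}$, where elements of the first summand are written with $\otimes$ and of the second with $\circ$, be given by $d_1(a\otimes b)=ab$, $d_1(a\circ b)=[a,b]$, $d_2(a\otimes b\otimes c)=ab\otimes c-a\otimes bc$, $d_2(a\circ b\circ c)=[a,c]\otimes b+a\otimes[b,c]-(ab)\circ c$. Then $H_1^{AWB}(A)=\mathrm{Ker}(d_1)/\mathrm{Im}(d_2)$ (first homology with trivial coefficients, also called the Schur multiplier), functorial in $A$. For a central extension $(G)$, $\theta(G):H_1^{AWB}(Q)\to N$ is the connecting map of the natural five-term exact sequence $H_1^{AWB}(G)\to H_1^{AWB}(Q)\xrightarrow{\theta(G)}N\to G/[[G,G]]\to Q/[[Q,Q]]\to 0$; explicitly, it sends the class of a cycle $\sum_i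 q_i\otimes q_i'+\sum_j p_j\circ p_j'$ to the element $n\in N$ with $\chi(n)=\sum_i s(q_i)s(q_i')+\sum_j[s(p_j),s(p_j')]$, for any linear section $s$ of $\pi$. Its image is (identifying $N$ with $\chi(N)$) $N\cap[[G,G]]$, and $\theta'(G):H_1^{AWB}(Q)\to[[G,G]]$ denotes $\theta(G)$ followed by the inclusion $N\cap[[G,G]]\subseteq[[G,G]]$. *)

(* Defs.v *)
From HB Require Import structures.
From mathcomp Require Import all_boot all_algebra.
From mathcomp Require Import generic_quotient ring_quotient.
From mathcomp Require Import mathcomp_extra boolp classical_sets.
From mathcomp Require Import finmap monalg.

Set Implicit Arguments.
Unset Strict Implicit.
Unset Printing Implicit Defensive.

Import GRing.Theory.

Local Open Scope classical_set_scope.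
Local Open Scope ring_scope.
Local Open Scope quotient_scope.

Reserved Notation "v \ox w" (at level 40, left associativity).
Reserved Notation "a ** b" (at level 40, left associativity).
Reserved Notation "'[br' a , b ]".
Reserved Notation "{ 'awb' A -> B }"
  (at level 0, A at level 98, B at level 99, format "{ 'awb'  A  ->  B }").

Section Span.
Variables (K : fieldType) (V : lmodType K) (X : set V).

Definition span : {pred V} := fun v =>
  `[< exists s : seq (K * V),
        (forall p, p \in s -> X p.2) /\ v = \sum_(p <- s) p.1 *: p.2 >].

Lemma spanP v : reflect
  (exists s : seq (K * V),
     (forall p, p \in s -> X p.2) /\ v = \sum_(p <- s) p.1 *: p.2)
  (v \in span).
Proof. exact: asboolP. Qed.

Lemma mem_span v : X v -> v \in span.
Proof.
move=> Xv; apply/spanP; exists [:: (1, v)]; split; last first.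
  by rewrite big_seq1 scale1r.
by move=> p; rewrite inE => /eqP ->.
Qed.

Lemma span_submod_closed : submod_closed span.
Proof.
split; first by apply/spanP; exists [::]; rewrite big_nil; split.
move=> a u v /spanP[s [sX ->]] /spanP[t [tX ->]]; apply/spanP.
exists ([seq (a * p.1, p.2) | p <- s] ++ t); split.
  move=> p; rewrite mem_cat => /orP[/mapP[q qs ->]|]; last exact: tX.
  by move: (sX _ qs).
rewrite big_cat big_map /=; congr (_ + _); rewrite scaler_sumr.
by apply: eq_bigr => p _; rewrite scalerA.
Qed.

HB.instance Definition _ := GRing.isSubmodClosed.Build K V span
  span_submod_closed.

Lemma span_min (S : submodClosed V) :
  (forall v, X v -> v \in S) -> forall v, v \in span -> v \in S.
Proof.
move=> XS v /spanP[s [sX ->]]; rewrite big_seq.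
by apply: rpred_sum => p /sX /XS pS; apply: rpredZ.
Qed.

End Span.

Section QuotientSpace.
Variables (K : fieldType) (V : lmodType K) (S : submodClosed V).

(* The library's quotients are over a zmodClosed predicate, and submodClosed
   does not inherit from it. *)
Definition submod_zmod : {pred V} := S.

Lemma submod_zmod_closed : zmod_closed submod_zmod.
Proof.
split; first exact: (rpred0 S).
move=> x y xS yS; rewrite -scaleN1r.
by apply: (@rpredD _ S) => //; apply: (rpredZ (s := S)).
Qed.

HB.instance Definition _ := GRing.isZmodClosed.Build V submod_zmod
  submod_zmod_closed.

Definition quotsp := Quotient.quot submod_zmod.
HB.instance Definition _ := Choice.on quotsp.
HB.instance Definition _ := GRing.Zmodule.on quotsp.
HB.instance Definition _ : EqQuotient V (Quotient.equiv submod_zmod) quotsp :=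
  EqQuotient.on quotsp.

Definition quotsp_proj (v : V) : quotsp := \pi_quotsp v.

Lemma quotsp_projP v w : (quotsp_proj v = quotsp_proj w) <-> (v - w \in S).
Proof.
have -> : (v - w \in S) = (v - w \in submod_zmod) by [].
by rewrite Quotient.idealrBE; split=> [vw|/eqP //]; apply/eqP.
Qed.

Lemma quotsp_reprK (q : quotsp) : quotsp_proj (repr q) = q.
Proof. exact: reprK. Qed.

Lemma quotsp_projD v w :
  quotsp_proj (v + w) = quotsp_proj v + quotsp_proj w.
Proof. by rewrite /quotsp_proj !piE. Qed.

Definition quotsp_scale (a : K) (q : quotsp) : quotsp :=
  quotsp_proj (a *: repr q).

Lemma quotsp_projZ a v :
  quotsp_proj (a *: v) = quotsp_scale a (quotsp_proj v).
Proof.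
apply/quotsp_projP; rewrite -scalerBr rpredZ //.
by apply/quotsp_projP; rewrite quotsp_reprK.
Qed.

Lemma quotsp_scaleA a b q :
  quotsp_scale a (quotsp_scale b q) = quotsp_scale (a * b) q.
Proof. by rewrite -[q]quotsp_reprK -!quotsp_projZ scalerA. Qed.

Lemma quotsp_scale1 : left_id 1 quotsp_scale.
Proof. by move=> q; rewrite -[q]quotsp_reprK -!quotsp_projZ scale1r. Qed.

Lemma quotsp_scaleDr : right_distributive quotsp_scale +%R.
Proof.
move=> a p q; rewrite -[p]quotsp_reprK -[q]quotsp_reprK.
by rewrite -quotsp_projD -!quotsp_projZ -quotsp_projD scalerDr.
Qed.

Lemma quotsp_scaleDl q : {morph quotsp_scale^~ q : a b / a + b}.
Proof.
move=> a b; rewrite -[q]quotsp_reprK -!quotsp_projZ -quotsp_projD.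
by rewrite scalerDl.
Qed.

HB.instance Definition _ := GRing.Zmodule_isLmodule.Build K quotsp
  quotsp_scaleA quotsp_scale1 quotsp_scaleDr quotsp_scaleDl.

Lemma quotsp_proj_linear : linear quotsp_proj.
Proof. by move=> a v w; rewrite quotsp_projD quotsp_projZ. Qed.

HB.instance Definition _ := GRing.isLinear.Build K V quotsp _ quotsp_proj
  quotsp_proj_linear.

End QuotientSpace.


Definition tensor_rel (K : fieldType) (V W : lmodType K) :
    set {malg K[(V * W)%type]} :=
  [set r | (exists (a : K) (v v' : V) (w : W),
              r = << (a *: v + v', w) >> - (a *: << (v, w) >> + << (v', w) >>))
        \/ (exists (a : K) (v : V) (w w' : W),
              r = << (v, a *: w + w') >>
                  - (a *: << (v, w) >> + << (v, w') >>))].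

(* V ⊗ W: the free vector space on V x W modulo the bilinearity relations. *)
Definition tensor (K : fieldType) (V W : lmodType K) :=
  quotsp (span (@tensor_rel K V W)).
HB.instance Definition _ (K : fieldType) (V W : lmodType K) :=
  GRing.Lmodule.on (tensor V W).

HB.lock Definition tens (K : fieldType) (V W : lmodType K) (v : V) (w : W) :
    tensor V W :=
  quotsp_proj (span (@tensor_rel K V W)) << (v, w) >>.

Notation "v \ox w" := (tens v w) : ring_scope.

Definition flift (K : fieldType) (X : choiceType) (U : lmodType K)
    (f : X -> U) (x : {malg K[X]}) : U :=
  \sum_(k <- msupp x) x@_k *: f k.

(* The linear map V ⊗ W -> U induced by f; meaningful for bilinear f only
   (see tliftE and tlift_uniq). *)
HB.lock Definition tlift (K : fieldType) (V W U : lmodType K) (f : V -> W -> U)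
    (t : tensor V W) : U :=
  flift (fun p : V * W => f p.1 p.2) (repr t).

Section FreeLift.
Variables (K : fieldType) (X : choiceType) (U : lmodType K) (f : X -> U).

Lemma fliftEw (x : {malg K[X]}) (d : {fset X}) : (msupp x `<=` d)%fset ->
  flift f x = \sum_(k <- d) x@_k *: f k.
Proof.
move=> xd; rewrite /flift (big_fset_incl _ xd) // => k _ kx.
by rewrite mcoeff_outdom // scale0r.
Qed.

Lemma flift_linear : linear (flift f).
Proof.
move=> a x y; pose d := (msupp x `|` msupp y `|` msupp (a *: x + y))%fset.
rewrite (@fliftEw x d) ?(@fliftEw y d) ?(@fliftEw (a *: x + y) d);
  do ?by apply/fsubsetP => k kx; rewrite !in_fsetE kx ?orbT.
rewrite scaler_sumr -big_split; apply: eq_bigr => k _.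
by rewrite mcoeffD mcoeffZ scalerDl scalerA.
Qed.

HB.instance Definition _ := GRing.isLinear.Build K {malg K[X]} U _ (flift f)
  flift_linear.

Lemma fliftU k : flift f << k >> = f k.
Proof.
by rewrite (@fliftEw _ [fset k]%fset) ?msuppU_le // big_seq_fset1 mcoeffUU scale1r.
Qed.

End FreeLift.

Section TensorTheory.
Variables (K : fieldType) (V W U : lmodType K).

Lemma tensPl a (v v' : V) (w : W) :
  (a *: v + v') \ox w = a *: (v \ox w) + v' \ox w.
Proof.
rewrite unlock -linearP; apply/quotsp_projP/mem_span; left.
by exists a, v, v', w.
Qed.

Lemma tensPr a (v : V) (w w' : W) :
  v \ox (a *: w + w') = a *: (v \ox w) + v \ox w'.
Proof.
rewrite unlock -linearP; apply/quotsp_projP/mem_span; right.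
by exists a, v, w, w'.
Qed.

Lemma tens_bilinear :
  bilinear_for *:%R *:%R (@tens K V W : V -> W -> tensor V W).
Proof. by split=> [w a v v'|v a w w'] /=; rewrite ?tensPl ?tensPr. Qed.

Lemma tensor_ind (P : tensor V W -> Prop) :
    P 0 -> (forall a v w t, P t -> P (a *: (v \ox w) + t)) ->
  forall t, P t.
Proof.
move=> P0 PD t; rewrite -[t]quotsp_reprK (monalgE (repr t)) linear_sum.
elim: (enum_fset _) => [|[v w] s IH]; first by rewrite big_nil.
rewrite big_cons; set x := << _ *g _ >>.
suff -> : x = (repr t)@_(v, w) *: << (v, w) >>.
  by rewrite linearZ /=; have := PD; rewrite unlock; apply.
by apply/malgP => k; rewrite mcoeffZ !mcoeffU mulr_natr.
Qed.

Variable f : V -> W -> U.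
Hypothesis f_bilinear : bilinear_for *:%R *:%R f.

Let fp (p : (V * W)%type) := f p.1 p.2.

Lemma flift_tensor_rel r : tensor_rel r -> flift fp r = 0.
Proof.
have [fl fr] := f_bilinear.
case=> [[a [v [v' [w ->]]]]|[a [v [w [w' ->]]]]].
  by rewrite linearB linearP /= !fliftU /fp /= fl subrr.
by rewrite linearB linearP /= !fliftU /fp /= fr subrr.
Qed.

Lemma tlift_proj x :
  tlift f (quotsp_proj (span (@tensor_rel K V W)) x) = flift fp x.
Proof.
rewrite unlock; apply/eqP; rewrite -subr_eq0 -linearB /=; set y := _ - x.
have /spanP[s [sr ->]] : y \in span (@tensor_rel K V W).
  by apply/quotsp_projP; rewrite quotsp_reprK.
rewrite linear_sum /= big_seq big1 // => p /sr /flift_tensor_rel p0.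
by rewrite linearZ /= p0 scaler0.
Qed.

Lemma tlift_linear : linear (tlift f).
Proof.
move=> a t u; rewrite -[t]quotsp_reprK -[u]quotsp_reprK -linearP /=.
by rewrite !tlift_proj linearP.
Qed.

Lemma tliftE v w : tlift f (v \ox w) = f v w.
Proof. by rewrite tens.unlock tlift_proj fliftU. Qed.

Lemma tlift0 : tlift f 0 = 0.
Proof.
by have := tlift_linear (-1) 0 0; rewrite scaler0 addr0 scaleN1r addNr.
Qed.

Lemma tliftD t u : tlift f (t + u) = tlift f t + tlift f u.
Proof. by have := tlift_linear 1 t u; rewrite !scale1r. Qed.

Lemma tliftN t : tlift f (- t) = - tlift f t.
Proof.
by have := tlift_linear (-1) t 0; rewrite tlift0 !addr0 !scaleN1r.
Qed.

Lemma tlift_uniq (g : {linear tensor V W -> U}) :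
  (forall v w, g (v \ox w) = f v w) -> g =1 tlift f.
Proof.
move=> gE; pose h := HB.pack_for {linear tensor V W -> U} (tlift f)
  (GRing.isLinear.Build K (tensor V W) U _ (tlift f) tlift_linear).
move=> t; rewrite -[tlift f t]/(h t); elim/tensor_ind: t => [|a v w t IH].
  by rewrite !linear0.
by rewrite !linearP IH gE /= tliftE.
Qed.

End TensorTheory.

HB.mixin Record Lmodule_isAWB (K : fieldType) A of GRing.Lmodule K A := {
  awb_mul : A -> A -> A;
  awb_br : A -> A -> A;
  awb_mul_bilinear : bilinear_for *:%R *:%R awb_mul;
  awb_br_bilinear : bilinear_for *:%R *:%R awb_br;
  awb_mulA : associative awb_mul;
  awb_brM : forall a b c,
    awb_br (awb_mul a b) c = awb_mul (awb_br a c) b + awb_mul a (awb_br b c)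
}.

#[short(type="awbType")]
HB.structure Definition AWB (K : fieldType) :=
  {A of GRing.Lmodule K A & Lmodule_isAWB K A}.

Notation "a ** b" := (awb_mul a b) : ring_scope.
Notation "'[br' a , b ]" := (awb_br a b) : ring_scope.

HB.mixin Record isAWBMorphism (K : fieldType) (A B : awbType K)
    (f : A -> B) := {
  awb_morphM : {morph f : a b / a ** b};
  awb_morph_br : forall a b, f [br a, b] = [br f a, f b]
}.

#[short(type="awb_morphism")]
HB.structure Definition AWBMorphism (K : fieldType) (A B : awbType K) :=
  {f of isAWBMorphism K A B f & @GRing.Linear K A B *:%R f}.

Notation "{ 'awb' A -> B }" := (awb_morphism A B) : type_scope.

Section AWBTheory.
Variables (K : fieldType) (A : awbType K).
Implicit Types a b c : A.

Definition in_center a :=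
  forall b, [/\ a ** b = 0, b ** a = 0, [br a, b] = 0 & [br b, a] = 0].

Lemma awb_mulDl a b c : (a + b) ** c = a ** c + b ** c.
Proof. by have := (@awb_mul_bilinear K A).1 c 1 a b; rewrite /= !scale1r. Qed.
Lemma awb_mulDr a b c : c ** (a + b) = c ** a + c ** b.
Proof. by have := (@awb_mul_bilinear K A).2 c 1 a b; rewrite /= !scale1r. Qed.
Lemma awb_brDl a b c : [br a + b, c] = [br a, c] + [br b, c].
Proof. by have := (@awb_br_bilinear K A).1 c 1 a b; rewrite /= !scale1r. Qed.
Lemma awb_brDr a b c : [br c, a + b] = [br c, a] + [br c, b].
Proof. by have := (@awb_br_bilinear K A).2 c 1 a b; rewrite /= !scale1r. Qed.

(* [[A, A]] is the linear span of all products and brackets. It is a two-sided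
   ideal, since every product or bracket with one factor in it is among the
   generators. *)
Definition derived_gen : set A :=
  [set x | exists a b, x = a ** b \/ x = [br a, b]].

Definition derived := {x : A | x \in span derived_gen}.

HB.instance Definition _ := SubChoice.on derived.
HB.instance Definition _ := [SubChoice_isSubLmodule of derived by <:].

Lemma mul_derived a b : a ** b \in span derived_gen.
Proof. by apply: mem_span; exists a, b; left. Qed.
Lemma br_derived a b : [br a, b] \in span derived_gen.
Proof. by apply: mem_span; exists a, b; right. Qed.

Definition derived_mul (x y : derived) : derived :=
  Sub (val x ** val y) (mul_derived _ _).
Definition derived_br (x y : derived) : derived :=
  Sub [br val x, val y] (br_derived _ _).

Lemma derived_mul_bilinear : bilinear_for *:%R *:%R derived_mul.
Proof.
split=> [z a x y|z a x y]; apply: val_inj; rewrite /= ?SubK.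
  exact: ((@awb_mul_bilinear K A).1 (val z)).
exact: ((@awb_mul_bilinear K A).2 (val z)).
Qed.

Lemma derived_br_bilinear : bilinear_for *:%R *:%R derived_br.
Proof.
split=> [z a x y|z a x y]; apply: val_inj; rewrite /= ?SubK.
  exact: ((@awb_br_bilinear K A).1 (val z)).
exact: ((@awb_br_bilinear K A).2 (val z)).
Qed.

Lemma derived_mulA : associative derived_mul.
Proof. by move=> x y z; apply: val_inj; rewrite /= awb_mulA. Qed.

Lemma derived_brM x y z :
  derived_br (derived_mul x y) z
    = derived_mul (derived_br x z) y + derived_mul x (derived_br y z).
Proof. by apply: val_inj; rewrite /= awb_brM. Qed.

HB.instance Definition _ := Lmodule_isAWB.Build K derived
  derived_mul_bilinear derived_br_bilinear derived_mulA derived_brM.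

End AWBTheory.

Section Homology.
Variables (K : fieldType) (A : awbType K).

Definition chain1 : lmodType K := (tensor A A * tensor A A)%type.
Definition chain2 : lmodType K :=
  (tensor (tensor A A) A * tensor (tensor A A) A)%type.

Definition d1 (x : chain1) : A :=
  tlift (fun a b : A => a ** b) x.1 + tlift (fun a b : A => [br a, b]) x.2.

(* d2 on a ⊗ b ⊗ c and on a ∘ b ∘ c; the second component of chain1 holds the
   ∘-tensors. *)
Definition d2_mul (a b c : A) : chain1 :=
  ((a ** b) \ox c - a \ox (b ** c), 0).
Definition d2_br (a b c : A) : chain1 :=
  ([br a, c] \ox b + a \ox [br b, c], - ((a ** b) \ox c)).

Definition tlift3 (U : lmodType K) (f : A -> A -> A -> U)
    (t : tensor (tensor A A) A) : U :=
  tlift (fun u c => tlift (fun a b => f a b c) u) t.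

Definition d2 (x : chain2) : chain1 := tlift3 d2_mul x.1 + tlift3 d2_br x.2.

Lemma d1_linear : linear d1.
Proof.
move=> a x y; rewrite /d1 /= !(tlift_linear (@awb_mul_bilinear K A)).
by rewrite !(tlift_linear (@awb_br_bilinear K A)) scalerDr addrACA.
Qed.
HB.instance Definition _ := GRing.isLinear.Build K chain1 A _ d1 d1_linear.

Section Trilinear.
Variables (U : lmodType K) (f : A -> A -> A -> U).
Hypothesis f12 : forall c, bilinear_for *:%R *:%R (fun a b => f a b c).
Hypothesis f3 : forall a b, linear (f a b).

Lemma tlift3_bilinear : bilinear_for *:%R *:%R
  (fun (u : tensor A A) (c : A) => tlift (fun a b => f a b c) u).
Proof.
split=> [c a u v|u a c c'] /=; first exact: (tlift_linear (f12 c)).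
elim/tensor_ind: u => [|k v w u IH].
  by rewrite !(tlift0 (f12 _)) scaler0 addr0.
rewrite !(tlift_linear (f12 _)) IH !(tliftE (f12 _)) f3 !scalerDr !scalerA.
by rewrite mulrC addrACA.
Qed.

Lemma tlift3E a b c : tlift3 f (a \ox b \ox c) = f a b c.
Proof. by rewrite /tlift3 (tliftE tlift3_bilinear) (tliftE (f12 c)). Qed.

Lemma tlift3_linear : linear (tlift3 f).
Proof. exact: (tlift_linear tlift3_bilinear). Qed.

Lemma tlift30 : tlift3 f 0 = 0.
Proof. exact: (tlift0 tlift3_bilinear). Qed.
End Trilinear.

Let mulPl (k : K) (a a' b : A) : (k *: a + a') ** b = k *: (a ** b) + a' ** b.
Proof. exact: (@awb_mul_bilinear K A).1. Qed.
Let mulPr (k : K) (a b b' : A) : a ** (k *: b + b') = k *: (a ** b) + a ** b'.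
Proof. exact: (@awb_mul_bilinear K A).2. Qed.
Let brPl (k : K) (a a' b : A) :
  [br k *: a + a', b] = k *: [br a, b] + [br a', b].
Proof. exact: (@awb_br_bilinear K A).1. Qed.
Let brPr (k : K) (a b b' : A) :
  [br a, k *: b + b'] = k *: [br a, b] + [br a, b'].
Proof. exact: (@awb_br_bilinear K A).2. Qed.

Let pairP (T : lmodType K) (k : K) (x y x' y' : T) :
  (k *: x + x', k *: y + y') = k *: (x, y) + (x', y').
Proof. by []. Qed.

Let linB (T : lmodType K) (k : K) (x x' y y' : T) :
  (k *: x + x') - (k *: y + y') = k *: (x - y) + (x' - y').
Proof. by rewrite scalerBr opprD addrACA. Qed.
Let linD (T : lmodType K) (k : K) (x x' y y' : T) :
  (k *: x + x') + (k *: y + y') = k *: (x + y) + (x' + y').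
Proof. by rewrite scalerDr addrACA. Qed.
Let linN (T : lmodType K) (k : K) (x x' : T) :
  - (k *: x + x') = k *: (- x) + (- x').
Proof. by rewrite opprD scalerN. Qed.

Lemma d2_mul12 c : bilinear_for *:%R *:%R (fun a b => d2_mul a b c).
Proof.
split=> [b k a a'|a k b b']; rewrite /= /d2_mul.
  by rewrite mulPl !tensPl linB -pairP scaler0 addr0.
by rewrite mulPl mulPr tensPl tensPr linB -pairP scaler0 addr0.
Qed.
Lemma d2_mul3 a b : linear (d2_mul a b).
Proof.
by move=> k c c'; rewrite /d2_mul mulPr !tensPr linB -pairP scaler0 addr0.
Qed.
Lemma d2_br12 c : bilinear_for *:%R *:%R (fun a b => d2_br a b c).
Proof.
split=> [b k a a'|a k b b']; rewrite /= /d2_br.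
  by rewrite brPl mulPl !tensPl linD linN -pairP.
by rewrite brPl mulPr !tensPl !tensPr linD linN -pairP.
Qed.
Lemma d2_br3 a b : linear (d2_br a b).
Proof.
by move=> k c c'; rewrite /d2_br !brPr !tensPl !tensPr linD linN -pairP.
Qed.

Lemma d2_linear : linear d2.
Proof.
move=> k x y; rewrite /d2 /= (tlift3_linear d2_mul12 d2_mul3).
by rewrite (tlift3_linear d2_br12 d2_br3) linD.
Qed.
HB.instance Definition _ := GRing.isLinear.Build K chain2 chain1 _ d2
  d2_linear.

Lemma d2_mulE a b c : d2 (a \ox b \ox c, 0) = d2_mul a b c.
Proof.
rewrite /d2 (tlift3E d2_mul12 d2_mul3) (tlift30 d2_br12 d2_br3).
exact: addr0.
Qed.

Lemma d2_brE a b c : d2 (0, a \ox b \ox c) = d2_br a b c.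
Proof.
rewrite /d2 (tlift3E d2_br12 d2_br3) (tlift30 d2_mul12 d2_mul3).
exact: add0r.
Qed.

Lemma tensor3_ind (P : tensor (tensor A A) A -> Prop) :
    (forall (k : K) x y, P x -> P y -> P (k *: x + y)) ->
    (forall a b c, P (a \ox b \ox c)) ->
  forall x, P x.
Proof.
move=> PD Pt; have P0 : P 0.
  have := PD (-1) _ _ (Pt 0 0 0) (Pt 0 0 0).
  by rewrite scaleN1r addNr.
apply: tensor_ind => [|k u c t]; first exact: P0.
apply: (PD k); move: u; apply: tensor_ind => [|k' a b u IH]; last first.
  by rewrite tensPl; apply: (PD k') IH; exact: Pt.
have := PD (-1) _ _ (Pt 0 0 c) (Pt 0 0 c).
rewrite scaleN1r addNr; suff -> : (0 : tensor A A) \ox c = 0 by [].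
have := tensPl (-1) (0 : tensor A A) 0 c.
by rewrite scaler0 addr0 scaleN1r addNr.
Qed.

Lemma chain2_ind (P : chain2 -> Prop) :
    (forall (k : K) x y, P x -> P y -> P (k *: x + y)) ->
    (forall a b c, P (a \ox b \ox c, 0)) ->
    (forall a b c, P (0, a \ox b \ox c)) ->
  forall x, P x.
Proof.
move=> PD P1 P2 [x y].
have -> : (x, y) = 1 *: (x, 0) + (0, y) :> chain2.
  by rewrite -pairP !scale1r addr0 add0r.
apply: (PD _).
  elim/tensor3_ind: x => // k u v Pu Pv; have := PD k _ _ Pu Pv.
  by rewrite -pairP scaler0 addr0.
elim/tensor3_ind: y => // k u v Pu Pv; have := PD k _ _ Pu Pv.
by rewrite -pairP scaler0 addr0.
Qed.

Lemma d1d2 x : d1 (d2 x) = 0.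
Proof.
elim/chain2_ind: x => [k x y x0 y0|a b c|a b c].
- by rewrite d2_linear d1_linear x0 y0 scaler0 addr0.
- rewrite d2_mulE /d1 /= (tlift0 (@awb_br_bilinear K A)) addr0.
  rewrite (tliftD (@awb_mul_bilinear K A)) (tliftN (@awb_mul_bilinear K A)).
  by rewrite !(tliftE (@awb_mul_bilinear K A)) awb_mulA subrr.
rewrite d2_brE /d1 /= (tliftN (@awb_br_bilinear K A)).
rewrite (tliftD (@awb_mul_bilinear K A)) !(tliftE (@awb_mul_bilinear K A)).
by rewrite (tliftE (@awb_br_bilinear K A)) awb_brM subrr.
Qed.

Definition is_cycle : {pred chain1} := fun x => d1 x == 0.

Lemma cycle_submod_closed : submod_closed is_cycle.
Proof.
split=> [|k x y /eqP x0 /eqP y0]; first by rewrite unfold_in linear0.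
by rewrite unfold_in d1_linear x0 y0 scaler0 addr0.
Qed.
HB.instance Definition _ := GRing.isSubmodClosed.Build K chain1 is_cycle
  cycle_submod_closed.

Definition cycle := {x : chain1 | x \in is_cycle}.
HB.instance Definition _ := SubChoice.on cycle.
HB.instance Definition _ := [SubChoice_isSubLmodule of cycle by <:].

(* Im d2, as a subspace of Ker d1; see d1d2 for the inclusion. *)
Definition boundary : {pred cycle} :=
  fun x => `[< exists y : chain2, val x = d2 y >].

Lemma boundaryP (x : cycle) :
  reflect (exists y : chain2, val x = d2 y) (x \in boundary).
Proof. exact: asboolP. Qed.

Lemma boundary_submod_closed : submod_closed boundary.
Proof.
split=> [|k u v /boundaryP[x xE] /boundaryP[y yE]]; apply/boundaryP.
  by exists 0; rewrite !linear0.
by exists (k *: x + y); rewrite d2_linear -xE -yE.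
Qed.
HB.instance Definition _ := GRing.isSubmodClosed.Build K cycle boundary
  boundary_submod_closed.

(* Degrees are shifted by one: the chains in degree n are two copies of
   A^{⊗(n+1)}, so this is Ker d1 / Im d2. *)
Definition H1 := quotsp boundary.
HB.instance Definition _ := GRing.Lmodule.on H1.

Definition H1_class (x : cycle) : H1 := quotsp_proj boundary x.
Lemma H1_class_linear : linear H1_class.
Proof. exact: quotsp_proj_linear. Qed.
HB.instance Definition _ := GRing.isLinear.Build K cycle H1 _ H1_class
  H1_class_linear.

Lemma H1_class_surj (h : H1) : exists x, h = H1_class x.
Proof. by exists (repr h); rewrite /H1_class quotsp_reprK. Qed.

Lemma H1_classP (x y : cycle) :
  H1_class x = H1_class y <-> exists z, val x - val y = d2 z.
Proof.
rewrite /H1_class quotsp_projP.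
by split=> [/boundaryP|xy]; [rewrite linearB|apply/boundaryP; rewrite linearB].
Qed.

End Homology.

Section HomologyMap.
Variables (K : fieldType) (A B : awbType K) (f : {awb A -> B}).

Definition tmap2 : tensor A A -> tensor B B :=
  tlift (fun a b : A => f a \ox f b).

Lemma tmap2_bilinear : bilinear_for *:%R *:%R (fun a b : A => f a \ox f b).
Proof. by split=> [b k a a'|a k b b'] /=; rewrite linearP ?tensPl ?tensPr. Qed.

Definition chain1_map (x : chain1 A) : chain1 B := (tmap2 x.1, tmap2 x.2).

Lemma chain1_map_linear : linear chain1_map.
Proof.
by move=> k x y; rewrite /chain1_map /tmap2 /= !(tlift_linear tmap2_bilinear).
Qed.

Lemma tmap2_mul (t : tensor A A) :
  tlift (fun a b : B => a ** b) (tmap2 t) = f (tlift (fun a b : A => a ** b) t).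
Proof.
elim/tensor_ind: t => [|k a b t IH].
  rewrite /tmap2 (tlift0 tmap2_bilinear) !(tlift0 (@awb_mul_bilinear K _)).
  by rewrite linear0.
rewrite /tmap2 (tlift_linear tmap2_bilinear) !(tlift_linear (@awb_mul_bilinear K _)).
rewrite IH linearP (tliftE tmap2_bilinear) !(tliftE (@awb_mul_bilinear K _)).
by rewrite /= awb_morphM.
Qed.

Lemma tmap2_br (t : tensor A A) :
  tlift (fun a b : B => [br a, b]) (tmap2 t)
    = f (tlift (fun a b : A => [br a, b]) t).
Proof.
elim/tensor_ind: t => [|k a b t IH].
  rewrite /tmap2 (tlift0 tmap2_bilinear) !(tlift0 (@awb_br_bilinear K _)).
  by rewrite linear0.
rewrite /tmap2 (tlift_linear tmap2_bilinear) !(tlift_linear (@awb_br_bilinear K _)).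
rewrite IH linearP (tliftE tmap2_bilinear) !(tliftE (@awb_br_bilinear K _)).
by rewrite /= awb_morph_br.
Qed.

Lemma d1_chain1_map x : d1 (chain1_map x) = f (d1 x).
Proof. by rewrite /d1 tmap2_mul tmap2_br linearD. Qed.

Lemma chain1_map_d2 (x : chain2 A) : exists y : chain2 B,
  chain1_map (d2 x) = d2 y.
Proof.
elim/chain2_ind: x => [k x y [x' xE] [y' yE]|a b c|a b c].
- exists (k *: x' + y').
  rewrite (d2_linear k x y) (d2_linear k x' y') -xE -yE.
  exact: chain1_map_linear.
- exists (f a \ox f b \ox f c, 0).
  rewrite !d2_mulE /d2_mul /chain1_map /tmap2 /= (tlift0 tmap2_bilinear).
  rewrite (tliftD tmap2_bilinear) (tliftN tmap2_bilinear).
  by rewrite !(tliftE tmap2_bilinear) !awb_morphM.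
exists (0, f a \ox f b \ox f c).
rewrite !d2_brE /d2_br /chain1_map /tmap2 /= (tliftN tmap2_bilinear).
rewrite (tliftD tmap2_bilinear) !(tliftE tmap2_bilinear).
by rewrite awb_morphM !awb_morph_br.
Qed.

Lemma cycle_map_subproof (x : cycle A) : chain1_map (val x) \in @is_cycle K B.
Proof.
by rewrite unfold_in d1_chain1_map (eqP (valP x : d1 _ == 0)) linear0.
Qed.

Definition cycle_map (x : cycle A) : cycle B := Sub (chain1_map (val x)) (cycle_map_subproof x).

Definition H1_map (h : H1 A) : H1 B := H1_class (cycle_map (repr h)).

Lemma H1_mapE x : H1_map (H1_class x) = H1_class (cycle_map x).
Proof.
apply/H1_classP; set y := repr _.
have /H1_classP[z yx] : H1_class y = H1_class x by exact: quotsp_reprK.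
have [z' zE] := chain1_map_d2 z; exists z'; rewrite -zE -yx /=.
have := chain1_map_linear (-1) (val x) (val y); rewrite !scaleN1r => cE.
by rewrite [LHS]addrC -cE [in RHS]addrC.
Qed.

Lemma H1_map_linear : linear H1_map.
Proof.
move=> k g h; have [x ->] := H1_class_surj g; have [y ->] := H1_class_surj h.
rewrite -H1_class_linear !H1_mapE -H1_class_linear.
by congr H1_class; apply: val_inj; rewrite /= chain1_map_linear.
Qed.
HB.instance Definition _ := GRing.isLinear.Build K (H1 A) (H1 B) _ H1_map
  H1_map_linear.

End HomologyMap.

Record central_extension (K : fieldType) (N G Q : awbType K) := CentralExtension {
  ext_inj : {awb N -> G};
  ext_proj : {awb G -> Q};
  ext_inj_injective : injective ext_inj;
  ext_exact : forall g, ext_proj g = 0 <-> exists n, ext_inj n = g;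
  ext_proj_surjective : forall q, exists g, ext_proj g = q;
  ext_central : forall n, in_center (ext_inj n)
}.

Section CentralExtension.
Variables (K : fieldType) (N G Q : awbType K) (E : central_extension N G Q).

Definition ext_lift (q : Q) : G := projT1 (cid (ext_proj_surjective E q)).

Lemma ext_liftK : cancel ext_lift (ext_proj E).
Proof. by move=> q; rewrite /ext_lift; case: cid. Qed.

(* The commutator maps; independence of the chosen preimages is commPE and
   commCE below. *)
Definition commP (q1 q2 : Q) : derived G :=
  Sub (ext_lift q1 ** ext_lift q2) (mul_derived _ _).
Definition commC (q1 q2 : Q) : derived G :=
  Sub [br ext_lift q1, ext_lift q2] (br_derived _ _).

Lemma ext_lift_proj g : exists n, g = ext_lift (ext_proj E g) + ext_inj E n.
Proof.
have /ext_exact[n nE] : ext_proj E (g - ext_lift (ext_proj E g)) = 0.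
  by rewrite linearB /= ext_liftK subrr.
by exists n; rewrite nE addrC subrK.
Qed.

Lemma ext_liftM g1 g2 :
  ext_lift (ext_proj E g1) ** ext_lift (ext_proj E g2) = g1 ** g2.
Proof.
have [n1 {2}->] := ext_lift_proj g1.
have [n2 {2}->] := ext_lift_proj g2.
have c1 := ext_central E n1; have c2 := ext_central E n2.
rewrite awb_mulDl !awb_mulDr.
case: (c2 (ext_lift (ext_proj E g1))) => _ -> _ _.
case: (c1 (ext_lift (ext_proj E g2))) => -> _ _ _.
by case: (c1 (ext_inj E n2)) => -> _ _ _; rewrite !addr0.
Qed.

Lemma ext_lift_br g1 g2 :
  [br ext_lift (ext_proj E g1), ext_lift (ext_proj E g2)] = [br g1, g2].
Proof.
have [n1 {2}->] := ext_lift_proj g1.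
have [n2 {2}->] := ext_lift_proj g2.
have c1 := ext_central E n1; have c2 := ext_central E n2.
rewrite awb_brDl !awb_brDr.
case: (c2 (ext_lift (ext_proj E g1))) => _ _ _ ->.
case: (c1 (ext_lift (ext_proj E g2))) => _ _ -> _.
by case: (c1 (ext_inj E n2)) => _ _ -> _; rewrite !addr0.
Qed.

Lemma commPE g1 g2 : val (commP (ext_proj E g1) (ext_proj E g2)) = g1 ** g2.
Proof. exact: ext_liftM. Qed.

Lemma commCE g1 g2 : val (commC (ext_proj E g1) (ext_proj E g2)) = [br g1, g2].
Proof. exact: ext_lift_br. Qed.

Lemma commP_bilinear : bilinear_for *:%R *:%R commP.
Proof.
split=> [q k p p'|p k q q']; apply: val_inj.
  rewrite -[q]ext_liftK -[p]ext_liftK -[p']ext_liftK -linearP [LHS]commPE.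
  by rewrite (@awb_mul_bilinear K G).1 linearP -!commPE.
rewrite -[q]ext_liftK -[p]ext_liftK -[q']ext_liftK -linearP [LHS]commPE.
by rewrite (@awb_mul_bilinear K G).2 linearP -!commPE.
Qed.

Lemma commC_bilinear : bilinear_for *:%R *:%R commC.
Proof.
split=> [q k p p'|p k q q']; apply: val_inj.
  rewrite -[q]ext_liftK -[p]ext_liftK -[p']ext_liftK -linearP [LHS]commCE.
  by rewrite (@awb_br_bilinear K G).1 linearP -!commCE.
rewrite -[q]ext_liftK -[p]ext_liftK -[q']ext_liftK -linearP [LHS]commCE.
by rewrite (@awb_br_bilinear K G).2 linearP -!commCE.
Qed.

Definition comm_chain (x : chain1 Q) : derived G :=
  tlift commP x.1 + tlift commC x.2.

Lemma comm_chain_linear : linear comm_chain.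
Proof.
move=> k x y; rewrite /comm_chain /= (tlift_linear commP_bilinear).
by rewrite (tlift_linear commC_bilinear) scalerDr addrACA.
Qed.
HB.instance Definition _ := GRing.isLinear.Build K (chain1 Q) (derived G) _
  comm_chain comm_chain_linear.

Lemma comm_chain_proj x : ext_proj E (val (comm_chain x)) = d1 x.
Proof.
have PE t : ext_proj E (val (tlift commP t)) = tlift (fun a b => a ** b) t.
  elim/tensor_ind: t => [|k a b t IH].
    by rewrite (tlift0 commP_bilinear) (tlift0 (@awb_mul_bilinear K Q)) linear0.
  rewrite (tlift_linear commP_bilinear) (tlift_linear (@awb_mul_bilinear K Q)).
  rewrite -IH (tliftE commP_bilinear) (tliftE (@awb_mul_bilinear K Q)).
  by rewrite !linearP /= awb_morphM !ext_liftK.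
have CE t : ext_proj E (val (tlift commC t)) = tlift (fun a b => [br a, b]) t.
  elim/tensor_ind: t => [|k a b t IH].
    by rewrite (tlift0 commC_bilinear) (tlift0 (@awb_br_bilinear K Q)) linear0.
  rewrite (tlift_linear commC_bilinear) (tlift_linear (@awb_br_bilinear K Q)).
  rewrite -IH (tliftE commC_bilinear) (tliftE (@awb_br_bilinear K Q)).
  by rewrite !linearP /= awb_morph_br !ext_liftK.
by rewrite /comm_chain !linearD /= PE CE.
Qed.

Lemma comm_chain_d2 (y : chain2 Q) : comm_chain (d2 y) = 0.
Proof.
elim/chain2_ind: y => [k x y x0 y0|a b c|a b c].
- by rewrite (d2_linear k x y) comm_chain_linear x0 y0 scaler0 addr0.
- rewrite d2_mulE /d2_mul /comm_chain /= (tlift0 commC_bilinear) addr0.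
  rewrite (tliftD commP_bilinear) (tliftN commP_bilinear).
  rewrite !(tliftE commP_bilinear); apply: val_inj.
  rewrite -[a]ext_liftK -[b]ext_liftK -[c]ext_liftK -!awb_morphM.
  by rewrite linearB linear0 /= !ext_liftM awb_mulA subrr.
rewrite d2_brE /d2_br /comm_chain /= (tliftN commC_bilinear).
rewrite (tliftD commP_bilinear) (tliftE commC_bilinear).
rewrite !(tliftE commP_bilinear); apply: val_inj.
rewrite -[a]ext_liftK -[b]ext_liftK -[c]ext_liftK -!awb_morphM -!awb_morph_br.
by rewrite linearB linearD linear0 /= !ext_liftM ext_lift_br awb_brM subrr.
Qed.

Lemma theta_subproof (x : cycle Q) :
  exists n, ext_inj E n = val (comm_chain (val x)).
Proof. by apply/ext_exact; rewrite comm_chain_proj; exact/eqP/(valP x). Qed.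

Definition theta_cycle (x : cycle Q) : N := projT1 (cid (theta_subproof x)).

(* Computed from the commutator maps; thetaE is the usual formula. *)
Definition theta (h : H1 Q) : N := theta_cycle (repr h).

Lemma theta_class x : ext_inj E (theta (H1_class x)) = val (comm_chain (val x)).
Proof.
rewrite /theta /theta_cycle; case: cid => n /= ->; set y := repr _.
have /H1_classP[z yx] : H1_class y = H1_class x by exact: quotsp_reprK.
have : comm_chain (val y - val x) = 0 by rewrite yx comm_chain_d2.
by rewrite linearB => /subr0_eq /(congr1 val).
Qed.

(* The defining formula of the connecting map, for an arbitrary section. *)
Lemma thetaE (s : Q -> G) (x : cycle Q) (u v : seq (Q * Q)) :
    cancel s (ext_proj E) ->
    val x = (\sum_(q <- u) q.1 \ox q.2, \sum_(p <- v) p.1 \ox p.2) ->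
  ext_inj E (theta (H1_class x))
    = \sum_(q <- u) s q.1 ** s q.2 + \sum_(p <- v) [br s p.1, s p.2].
Proof.
move=> sK xE; rewrite theta_class xE /comm_chain linearD /=; congr (_ + _).
  elim: u {xE} => [|[a b] u IH].
    by rewrite !big_nil (tlift0 commP_bilinear).
  rewrite !big_cons (tliftD commP_bilinear) -IH.
  congr (_ + _); rewrite (tliftE commP_bilinear).
have := commPE (s a) (s b); rewrite !sK; exact.
elim: v {xE} => [|[a b] v IH].
  by rewrite !big_nil (tlift0 commC_bilinear).
rewrite !big_cons (tliftD commC_bilinear) -IH.
congr (_ + _); rewrite (tliftE commC_bilinear).
have := commCE (s a) (s b); rewrite !sK; exact.
Qed.

Lemma theta_linear : linear theta.
Proof.
move=> k g h; have [x ->] := H1_class_surj g; have [y ->] := H1_class_surj h.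
rewrite -H1_class_linear; apply: (@ext_inj_injective _ _ _ _ E).
rewrite [RHS]linearP /= !theta_class.
exact: (congr1 val (comm_chain_linear k (val x) (val y))).
Qed.
HB.instance Definition _ := GRing.isLinear.Build K (H1 Q) N _ theta
  theta_linear.

Lemma theta_derived h : ext_inj E (theta h) \in span (@derived_gen K G).
Proof.
by have [x ->] := H1_class_surj h; rewrite theta_class; exact: valP.
Qed.

Definition theta' (h : H1 Q) : derived G :=
  Sub (ext_inj E (theta h)) (theta_derived h).

End CentralExtension.

Definition isoclinism (K : fieldType) (N1 G1 Q1 N2 G2 Q2 : awbType K)
    (E1 : central_extension N1 G1 Q1) (E2 : central_extension N2 G2 Q2)
    (eta : {awb Q1 -> Q2}) (xi : {awb derived G1 -> derived G2}) : Prop :=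
  [/\ bijective eta, bijective xi,
      forall q q' : Q1, xi (commC E1 q q') = commC E2 (eta q) (eta q')
    & forall q q' : Q1, xi (commP E1 q q') = commP E2 (eta q) (eta q')].

(* Main.v *)
Require Import Defs.
From HB Require Import structures.
From mathcomp Require Import all_boot all_algebra.
From mathcomp Require Import boolp classical_sets.

(** The commutator maps of a central extension [E] of [Q] by [N] with total
    algebra [G] assemble into one linear map [comm_chain E] from the 1-chains
    of [Q] to [[G, G]]. Three facts about this map carry the proof.

    - It is onto, because the products and brackets of [G] that span [[G, G]]
      depend only on the images of their factors in [Q]
      ([comm_chain_surj]).
    - A chain that it kills is a cycle, because it lifts [d1] along the
      projection; on cycles it is [theta'] of the homology class. So its kernel
      is the preimage of [Ker (theta E)] in the cycles ([comm_chain_eq0]).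
    - Being compatible with the commutator maps over [eta] is, for a linear map
      [xi], the same as the identity
      [xi (comm_chain E1 x) = comm_chain E2 (chain1_map eta x)]
      ([comm_compatP]).

    Hence [xi], if it exists, is determined by [eta], and it exists as a
    bijection exactly when [chain1_map eta] matches the two kernels, which, as
    [eta] is invertible, says that [H1_map eta] matches the kernels of the maps
    [theta] ([comm_chain_map_eq0]). Such a bijection is automatically
    multiplicative: a product in [[G, G]] is a commutator value at the
    projections of its factors, and these projections are computed by [d1],
    which is natural. This gives (c) => (a); restricting the identity for [xi]
    to cycles gives (a) => (b), and comparing kernels gives (b) => (c). *)

Set Implicit Arguments.
Unset Strict Implicit.
Unset Printing Implicit Defensive.

Import GRing.Theory.

Local Open Scope classical_set_scope.
Local Open Scope ring_scope.

(** * Linear algebra *)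

Lemma inj_surj_bijective (S T : Type) (f : S -> T) :
  injective f -> (forall y, exists x, f x = y) -> bijective f.
Proof.
move=> f_inj f_surj; pose g y := projT1 (cid (f_surj y)).
have gK : cancel g f by move=> y; rewrite /g; case: cid.
by exists g => // x; apply: f_inj; rewrite gK.
Qed.

Section LinearFactor.
Variables (K : fieldType) (U V W : lmodType K).
Variables (p : {linear U -> V}) (f : {linear U -> W}).
Hypothesis p_surj : forall v, exists u, p u = v.

Lemma linear_factor : (forall u, p u = 0 -> f u = 0) ->
  exists g : {linear V -> W}, forall u, g (p u) = f u.
Proof.
move=> pf; pose g v := f (projT1 (cid (p_surj v))).
have gE u : g (p u) = f u.
  rewrite /g; case: cid => u' /= u'E; apply/eqP; rewrite -subr_eq0 -linearB.
  by apply/eqP/pf; rewrite linearB u'E subrr.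
have g_lin : linear g.
  move=> k v w; have [x <-] := p_surj v; have [y <-] := p_surj w.
  by rewrite -linearP !gE linearP.
by exists (HB.pack_for {linear V -> W} g (GRing.isLinear.Build K V W _ g g_lin)).
Qed.

Lemma linear_factor_bijective (g : {linear V -> W}) :
    (forall u, g (p u) = f u) -> (forall u, f u = 0 -> p u = 0) ->
  (forall w, exists u, f u = w) -> bijective g.
Proof.
move=> gE fp f_surj; apply: inj_surj_bijective => [v w|w]; last first.
  by have [u <-] := f_surj w; exists (p u).
have [x <-] := p_surj v; have [y <-] := p_surj w; rewrite !gE => xy.
apply/eqP; rewrite -subr_eq0 -linearB; apply/eqP/fp.
by rewrite linearB xy subrr.
Qed.

End LinearFactor.

(** * Functoriality of the first homology *)

Section Functoriality.
Variables (K : fieldType) (A B : awbType K).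

Lemma awb_inverse (f : {awb A -> B}) : bijective f ->
  exists g : {awb B -> A}, cancel f g /\ cancel g f.
Proof.
case=> g fK gK; have f_inj := can_inj fK.
have g_lin : linear g by move=> k x y; apply: f_inj; rewrite gK linearP /= !gK.
have gM : {morph g : a b / a ** b}.
  by move=> x y; apply: f_inj; rewrite awb_morphM !gK.
have g_br x y : g [br x, y] = [br g x, g y].
  by apply: f_inj; rewrite awb_morph_br !gK.
exists (HB.pack_for {awb B -> A} g (GRing.isLinear.Build K B A _ g g_lin)
  (isAWBMorphism.Build K B A g gM g_br)).
by split.
Qed.

Variables (f : {awb A -> B}) (g : {awb B -> A}).
Hypothesis fK : cancel f g.

Lemma tmap2K : cancel (tmap2 f) (tmap2 g).
Proof.
move=> t; elim/tensor_ind: t => [|k a b t IH]; rewrite /tmap2.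
  by rewrite (tlift0 (tmap2_bilinear f)) (tlift0 (tmap2_bilinear g)).
rewrite (tlift_linear (tmap2_bilinear f)) (tliftE (tmap2_bilinear f)).
rewrite (tlift_linear (tmap2_bilinear g)) (tliftE (tmap2_bilinear g)) /= !fK.
by congr (_ + _); exact: IH.
Qed.

Lemma chain1_mapK : cancel (chain1_map f) (chain1_map g).
Proof. by case=> x y; rewrite /chain1_map /= !tmap2K. Qed.

Lemma H1_mapK : cancel (H1_map f) (H1_map g).
Proof.
move=> h; have [x ->] := H1_class_surj h; rewrite !H1_mapE; congr H1_class.
by apply: val_inj; exact: chain1_mapK.
Qed.

End Functoriality.

HB.instance Definition _ (K : fieldType) (A B : awbType K) (f : {awb A -> B}) :=
  GRing.isLinear.Build K (chain1 A) (chain1 B) _ (chain1_map f)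
    (chain1_map_linear f).

(** * The commutator map on chains *)

Section CommChain.
Variables (K : fieldType) (N G Q : awbType K) (E : central_extension N G Q).

Lemma comm_chainP q q' : comm_chain E (q \ox q', 0) = commP E q q'.
Proof.
rewrite /comm_chain /= (tliftE (commP_bilinear E)).
by rewrite (tlift0 (commC_bilinear E)) addr0.
Qed.

Lemma comm_chainC q q' : comm_chain E (0, q \ox q') = commC E q q'.
Proof.
rewrite /comm_chain /= (tliftE (commC_bilinear E)).
by rewrite (tlift0 (commP_bilinear E)) add0r.
Qed.

(** By centrality, the product or bracket of two elements of [G] is the
    commutator value at their projections, so every generator is hit. *)
Lemma comm_chain_surj (g : derived G) : exists x, comm_chain E x = g.
Proof.
have [s [sX gE]] := spanP _ _ (valP g).
suff [x xE] : exists x, val (comm_chain E x) = val g.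
  by exists x; exact: val_inj.
rewrite {}gE; elim: s sX => [_|p s IH sX].
  by exists 0; rewrite big_nil !linear0.
have [q qs|x xE] := IH; first by apply: sX; rewrite inE qs orbT.
rewrite big_cons -xE.
have [a [b [->|->]]] : derived_gen p.2 by apply: sX; rewrite mem_head.
  exists (p.1 *: (ext_proj E a \ox ext_proj E b, 0) + x).
  by rewrite comm_chain_linear comm_chainP linearP -(commPE E).
exists (p.1 *: (0, ext_proj E a \ox ext_proj E b) + x).
by rewrite comm_chain_linear comm_chainC linearP -(commCE E).
Qed.

Lemma theta'_class c : theta' E (H1_class c) = comm_chain E (val c).
Proof. by apply: val_inj; exact: theta_class. Qed.

Lemma theta'_eq0 h : theta' E h = 0 <-> theta E h = 0.
Proof.
split=> [/(congr1 val) /= h0|h0]; last first.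
  by apply: val_inj; rewrite /= h0 !linear0.
by apply: (@ext_inj_injective _ _ _ _ E); rewrite h0 !linear0.
Qed.

(** The projection of [comm_chain E x] to [Q] is [d1 x], whence a chain in the
    kernel is a cycle. *)
Lemma comm_chain_eq0 x : comm_chain E x = 0 <->
  exists2 c : Defs.cycle Q, val c = x & theta E (H1_class c) = 0.
Proof.
split=> [x0|[c <- /theta'_eq0]]; last by rewrite theta'_class.
have xc : x \in @is_cycle K Q.
  by rewrite unfold_in -(comm_chain_proj E) x0 !linear0.
by exists (Sub x xc) => //; apply/theta'_eq0; rewrite theta'_class.
Qed.

Lemma mul_comm_chain x y :
  comm_chain E x ** comm_chain E y = commP E (d1 x) (d1 y).
Proof. by apply: val_inj; rewrite -!(comm_chain_proj E) commPE. Qed.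

Lemma br_comm_chain x y :
  [br comm_chain E x, comm_chain E y] = commC E (d1 x) (d1 y).
Proof. by apply: val_inj; rewrite -!(comm_chain_proj E) commCE. Qed.

End CommChain.

(** * Comparing two central extensions *)

Section Comparison.
Variables (K : fieldType) (N1 G1 Q1 N2 G2 Q2 : awbType K).
Variables (E1 : central_extension N1 G1 Q1) (E2 : central_extension N2 G2 Q2).
Variable eta : {awb Q1 -> Q2}.

Section Compatibility.
Variable xi : {linear derived G1 -> derived G2}.

(** The chain identity on the right, evaluated at decomposable chains, is the
    compatibility on the left; these chains span. *)
Lemma comm_compatP :
  ((forall q q', xi (commC E1 q q') = commC E2 (eta q) (eta q')) /\
   (forall q q', xi (commP E1 q q') = commP E2 (eta q) (eta q'))) <->
  (forall x, xi (comm_chain E1 x) = comm_chain E2 (chain1_map eta x)).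
Proof.
have etaB := tmap2_bilinear eta.
split=> [[xiC xiP] [t u]|xiE]; last first.
  split=> q q'.
    rewrite -comm_chainC xiE /chain1_map /tmap2 /=.
    by rewrite (tlift0 etaB) (tliftE etaB) comm_chainC.
  rewrite -comm_chainP xiE /chain1_map /tmap2 /=.
  by rewrite (tlift0 etaB) (tliftE etaB) comm_chainP.
have tE f1 f2 v : bilinear_for *:%R *:%R f1 -> bilinear_for *:%R *:%R f2 ->
    (forall q q', xi (f1 q q') = f2 (eta q) (eta q')) ->
  xi (tlift f1 v) = tlift f2 (tmap2 eta v).
  move=> f1B f2B fE; elim/tensor_ind: v => [|k a b v IH]; rewrite /tmap2.
    by rewrite (tlift0 f1B) (tlift0 etaB) (tlift0 f2B) linear0.
  rewrite (tlift_linear f1B) (tliftE f1B) (tlift_linear etaB) (tliftE etaB).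
  rewrite (tlift_linear f2B) (tliftE f2B) linearP /= fE.
  by congr (_ + _); exact: IH.
rewrite /comm_chain /= linearD /=.
rewrite (tE _ _ _ (commP_bilinear E1) (commP_bilinear E2) xiP).
by rewrite (tE _ _ _ (commC_bilinear E1) (commC_bilinear E2) xiC).
Qed.

Hypothesis xiE :
  forall x, xi (comm_chain E1 x) = comm_chain E2 (chain1_map eta x).

(** The restriction of the hypothesis to cycles. *)
Lemma comm_compat_theta' h : xi (theta' E1 h) = theta' E2 (H1_map eta h).
Proof.
have [c ->] := H1_class_surj h.
by rewrite H1_mapE !theta'_class xiE.
Qed.

(** Every element of [[G1, G1]] is a [comm_chain], and products of those are
    commutator values at points given by the natural map [d1]. *)
Lemma comm_compat_awb : exists f : {awb derived G1 -> derived G2}, f =1 xi.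
Proof.
have [xiC xiP] := comm_compatP.2 xiE.
have xiM : {morph xi : a b / a ** b}.
  move=> a b; have [x <-] := comm_chain_surj E1 a.
  have [y <-] := comm_chain_surj E1 b.
  by rewrite !xiE !mul_comm_chain xiP !d1_chain1_map.
have xi_br a b : xi [br a, b] = [br xi a, xi b].
  have [x <-] := comm_chain_surj E1 a; have [y <-] := comm_chain_surj E1 b.
  by rewrite !xiE !br_comm_chain xiC !d1_chain1_map.
by exists (HB.pack_for {awb derived G1 -> derived G2} (xi : _ -> _)
  (GRing.isLinear.Build K _ _ _ xi (linearP xi))
  (isAWBMorphism.Build K _ _ xi xiM xi_br)).
Qed.

End Compatibility.

Hypothesis eta_iso : bijective eta.

Lemma chain1_map_surj y : exists x, chain1_map eta x = y.
Proof.
have [g [_ gK]] := awb_inverse eta_iso.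
by exists (chain1_map g y); exact: chain1_mapK.
Qed.

Lemma H1_map_bijective : bijective (H1_map eta).
Proof.
have [g [fK gK]] := awb_inverse eta_iso.
by exists (H1_map g); exact: H1_mapK.
Qed.

Lemma theta_ker_image :
  ([set H1_map eta h | h in [set h : H1 Q1 | theta E1 h = 0]]
     = [set h : H1 Q2 | theta E2 h = 0]) <->
  (forall h, theta E1 h = 0 <-> theta E2 (H1_map eta h) = 0).
Proof.
have [g fK gK] := H1_map_bijective.
split=> [kerE h|kerE].
  change (theta E1 h = 0 <-> [set k | theta E2 k = 0] (H1_map eta h)).
  rewrite -kerE; split=> [h0|[h' /= h'0 /(can_inj fK) <- //]].
  by exists h.
apply/seteqP; split=> [_ [h /= h0 <-]|h /= h0]; first exact/kerE.
by exists (g h); rewrite ?gK //=; apply/kerE; rewrite gK.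
Qed.

(** A chain killed on either side is a cycle, as [eta] is injective, and on
    cycles the claim is the hypothesis. *)
Lemma comm_chain_map_eq0 :
    (forall h, theta E1 h = 0 <-> theta E2 (H1_map eta h) = 0) ->
  forall x, comm_chain E1 x = 0 <-> comm_chain E2 (chain1_map eta x) = 0.
Proof.
move=> kerE x; split=> [/comm_chain_eq0[c <- /kerE]|x0].
  by rewrite H1_mapE -theta'_eq0 theta'_class.
have xc : x \in @is_cycle K Q1.
  rewrite unfold_in; apply/eqP/(bij_inj eta_iso).
  by rewrite -d1_chain1_map -(comm_chain_proj E2) x0 !linear0.
apply/comm_chain_eq0; exists (Sub x xc) => //.
by apply/kerE/theta'_eq0; rewrite H1_mapE theta'_class.
Qed.

Lemma isoclinism_of_theta_ker :
    (forall h, theta E1 h = 0 <-> theta E2 (H1_map eta h) = 0) ->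
  exists xi : {awb derived G1 -> derived G2}, isoclinism E1 E2 eta xi.
Proof.
move=> /comm_chain_map_eq0 kerE.
pose c2 : {linear chain1 Q1 -> derived G2} := comm_chain E2 \o chain1_map eta.
have [xi xiE] := linear_factor (f := c2) (comm_chain_surj E1)
  (fun x => (kerE x).1).
have xi_bij : bijective xi.
  apply: (linear_factor_bijective (f := c2) (comm_chain_surj E1) xiE).
    by move=> x /kerE.
  move=> g; have [y <-] := comm_chain_surj E2 g.
  by have [x <-] := chain1_map_surj y; exists x.
have [xiC xiP] := (comm_compatP xi).2 xiE.
have [f fE] := comm_compat_awb xiE.
exists f; split=> // [|q q'|q q']; rewrite ?fE //.
by apply: eq_bij xi_bij _ _ => x; rewrite fE.
Qed.

Lemma theta'_iso_of_isoclinism (xi : {awb derived G1 -> derived G2}) :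
  isoclinism E1 E2 eta xi ->
  forall h, xi (theta' E1 h) = theta' E2 (H1_map eta h).
Proof. by case=> _ _ xiC xiP; apply/comm_compat_theta'/comm_compatP. Qed.

Lemma theta_ker_of_theta'_iso (beta' : {awb derived G1 -> derived G2}) :
    injective beta' ->
    (forall h, beta' (theta' E1 h) = theta' E2 (H1_map eta h)) ->
  forall h, theta E1 h = 0 <-> theta E2 (H1_map eta h) = 0.
Proof.
move=> beta_inj betaE h; rewrite -!theta'_eq0 -betaE.
split=> [->|h0]; first exact: linear0.
by apply: beta_inj; rewrite h0 linear0.
Qed.

End Comparison.

Theorem theorem4p3 (K : fieldType) (N1 G1 Q1 N2 G2 Q2 : awbType K)
    (E1 : central_extension N1 G1 Q1) (E2 : central_extension N2 G2 Q2)
    (eta : {awb Q1 -> Q2}) (eta_iso : bijective eta) :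
  ((exists xi : {awb derived G1 -> derived G2}, isoclinism E1 E2 eta xi) <->
   (exists beta' : {awb derived G1 -> derived G2},
      bijective beta' /\
      forall h : H1 Q1, beta' (theta' E1 h) = theta' E2 (H1_map eta h))) /\
  ((exists beta' : {awb derived G1 -> derived G2},
      bijective beta' /\
      forall h : H1 Q1, beta' (theta' E1 h) = theta' E2 (H1_map eta h)) <->
   [set H1_map eta h | h in [set h : H1 Q1 | theta E1 h = 0]]
     = [set h : H1 Q2 | theta E2 h = 0]).
Proof.
rewrite (theta_ker_image E1 E2 eta_iso).
set a := ex _; set b := ex _.
have ab : a -> b.
  by move=> [xi iso]; exists xi; split;
    [case: iso|exact: theta'_iso_of_isoclinism].
have bc : b -> forall h, theta E1 h = 0 <-> theta E2 (H1_map eta h) = 0.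
  by move=> [beta' [/bij_inj]]; exact: theta_ker_of_theta'_iso.
have ca := isoclinism_of_theta_ker eta_iso.
by split; split=> //; [move=> /bc/ca | move=> /ca/ab].
Qed.
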